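(* For $W_\infty\in\mathcal W_v$, $\boldsymbol\alpha=(\alpha_1,\ldots,\alpha_c)\in\mathbb R^c$ and $\boldsymbol h=(h_1,\ldots,h_c)\in\mathbb R^c$, consider the optimization problem $$\sup_{\boldsymbol f\in\mathcal F_c}\left\{\sum_{r=1}^c\alpha_rG_{W_\infty,\mathbf 1_r}(\boldsymbol f)+\sum_{r=1}^c h_r\int_0^1 f_r(u)\,du-\int_0^1\sum_{r=1}^c f_r(u)\log f_r(u)\,du\right\}.$$ Then the following hold. (i) (Characterization of optimizers) If $\boldsymbol f=(f_1,\ldots,f_c)$ is a maximizer, then for every $r\in[c]$ and Lebesgue-a.e. $x\in[0,1]$, $$f_r(x)=\frac{\exp\big(\alpha_rv\,\mathcal V_r[W_\infty,\boldsymbol f](x)+h_r\big)}{\sum_{s=1}^c\exp\big(\alpha_sv\,\mathcal V_s[W_\infty,\boldsymbol f](x)+h_s\big)}.$$ (ii) (Replica-symmetry breaking) Suppose there exist $r,s\in[c]$ such that $\alpha_re^{(v-1)h_r}\ne\alpha_se^{(v-1)h_s}$, and that $\mathcal V[W_\infty](\cdot)$ is not Lebesgue-a.e. constant. Then none of the maximizers are Lebesgue-a.e. constant. (iii) (Replica symmetry) If $\mathcal V[W_\infty](\cdot)=1$ Lebesgue-a.e., $W_\infty>0$ Lebesgue-a.e., and $\alpha_r\ge0$ for all $r\in[c]$, then all of the maximizers are Lebesgue-a.e. constant.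
   Context: Integers $c,v\ge2$ are fixed and $[m]:=\{1,\ldots,m\}$. $\mathcal W_v$ is the space of symmetric real-valued functions in $L^1([0,1]^v)$. $\mathcal F_c$ is the set of measurable $\boldsymbol f=(f_1,\ldots,f_c):[0,1]\to[0,1]^c$ with $\sum_{r=1}^c f_r(x)=1$ for all $x$ (modulo a.e. equality). For $W\in\mathcal W_v$, $\boldsymbol f\in\mathcal F_c$, $$G_{W,\mathbf 1_r}(\boldsymbol f):=\int_{[0,1]^v}W(x_1,\ldots,x_v)\prod_{a=1}^v f_r(x_a)\,dx_1\cdots dx_v,$$ $$\mathcal V[W](x):=\int_{[0,1]^{v-1}}W(x,x_2,\ldots,x_v)\prod_{a=2}^v dx_a,\qquad \mathcal V_r[W,\boldsymbol f](x):=\int_{[0,1]^{v-1}}W(x,x_2,\ldots,x_v)\prod_{a=2}^v f_r(x_a)\prod_{a=2}^v dx_a.$$ Convention: $0\log0=0$. *)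

(* Defs.v *)
From HB Require Import structures.
From mathcomp Require Import all_boot all_order all_algebra.
From mathcomp Require Import perm.
From mathcomp Require Import all_classical all_reals all_analysis.

Set Implicit Arguments.
Unset Strict Implicit.
Unset Printing Implicit Defensive.
Import Order.TTheory GRing.Theory Num.Theory.
Import numFieldNormedType.Exports.

Local Open Scope classical_set_scope.
Local Open Scope ring_scope.

Section measure_cons.
Context {d : measure_display} {T : measurableType d} {R : realType} {n : nat}.
Variables (m1 : {sigma_finite_measure set T -> \bar R})
  (m2 : {sigma_finite_measure set (n.-tuple T) -> \bar R}).

Definition cons_pair (p : T * n.-tuple T) : n.+1.-tuple T :=
  [the n.+1.-tuple T of p.1 :: p.2].

Definition uncons (t : n.+1.-tuple T) : T * n.-tuple T :=
  (thead t, [tuple of behead t]).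

Lemma cons_pairK : cancel cons_pair uncons.
Proof.
by case=> x t; rewrite /uncons /cons_pair/=; congr pair; apply/val_inj.
Qed.

Lemma measurable_cons_pair : measurable_fun [set: T * n.-tuple T] cons_pair.
Proof. exact: measurable_cons. Qed.

Lemma measurable_uncons : measurable_fun [set: n.+1.-tuple T] uncons.
Proof.
apply: measurable_fun_pair; first exact: measurable_tnth.
exact: measurable_behead.
Qed.

(* product of m1 and m2, transported from T * T^n to T^(n+1) *)
Definition measure_cons : set (n.+1.-tuple T) -> \bar R :=
  pushforward (m1 \x m2)%E cons_pair.

Let measure_cons0 : measure_cons set0 = 0%E.
Proof. by rewrite /measure_cons /pushforward preimage_set0 measure0. Qed.

Let measure_cons_ge0 A : (0 <= measure_cons A)%E.
Proof. exact: (measure_ge0 (m1 \x m2)%E). Qed.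

Let measure_cons_sigma_additive : semi_sigma_additive measure_cons.
Proof.
have mcons A : measurable A -> measurable (cons_pair @^-1` A).
  by move=> mA; rewrite -[X in measurable X]setTI; exact: measurable_cons_pair.
move=> F mF tF mUF; rewrite /measure_cons /pushforward preimage_bigcup.
apply: (@measure_semi_sigma_additive _ _ _ (m1 \x m2)%E).
- by move=> k; exact: mcons.
- apply/trivIsetP => /= i j _ _ ij; rewrite -preimage_setI.
  by move/trivIsetP : tF => /(_ _ _ _ _ ij) ->//; rewrite preimage_set0.
- by rewrite -preimage_bigcup; exact: mcons.
Qed.

HB.instance Definition _ := isMeasure.Build _ _ _ measure_cons
  measure_cons0 measure_cons_ge0 measure_cons_sigma_additive.

Let measure_cons_sigma_finite : sigma_finite setT measure_cons.
Proof.
have /sigma_finiteP[F [TF ndF Foo]] := sigma_finiteT m1.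
have /sigma_finiteP[G [TG ndG Goo]] := sigma_finiteT m2.
exists (fun k => uncons @^-1` (F k `*` G k)).
  rewrite -preimage_bigcup -(preimage_setT uncons); congr (_ @^-1` _).
  rewrite -setXTT TF TG predeqE => -[x y]; split => [|[n0 _ []/= ? ?]].
    move=> [/= [i _ Fix] [j _ Gjy]]; exists (maxn i j) => //; split.
      by move: x Fix; exact/subsetPset/ndF/leq_maxl.
    by move: y Gjy; exact/subsetPset/ndG/leq_maxr.
  by split; exists n0.
move=> k; have [mFk Fkoo] := Foo k; have [mGk Gkoo] := Goo k; split.
  by rewrite -[X in measurable X]setTI; apply: measurable_uncons => //;
    exact: measurableX.
rewrite /measure_cons /pushforward -comp_preimage.
rewrite (_ : uncons \o cons_pair = id); last first.
  by apply/funext => p /=; rewrite cons_pairK.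
by rewrite preimage_id product_measure1E// lte_mul_pinfty// ge0_fin_numE.
Qed.

HB.instance Definition _ := Measure_isSigmaFinite.Build _ _ _ measure_cons
  measure_cons_sigma_finite.

End measure_cons.

(* n-dimensional Lebesgue measure, on n.-tuples of reals *)
Fixpoint lebesgue_tuple (R : realType) (n : nat) :
    {sigma_finite_measure set (n.-tuple (measurableTypeR R)) -> \bar R} :=
  match n with
  | 0 => \d_([tuple] : 0.-tuple (measurableTypeR R))
  | m.+1 => measure_cons (@lebesgue_measure R) (lebesgue_tuple R m)
  end.

(* All integrals below are with respect to Lebesgue measure on Borel sets; as
   every Lebesgue measurable function agrees a.e. with a Borel one, this is no
   restriction for functions considered up to a.e. equality. *)

Definition unit_cube (R : realType) (n : nat) : set (n.-tuple R) :=
  [set t | forall i, tnth t i \in `[0, 1]].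
Arguments unit_cube : clear implicits.

(* Almost everywhere on [0,1], resp. on [0,1]^n; the values of the functions
   outside the unit interval or cube never matter. *)
Definition ae_unit (R : realType) (P : R -> Prop) : Prop :=
  \forall x \ae (@lebesgue_measure R), x \in `[0, 1] -> P x.

Definition ae_cube (R : realType) (n : nat) (P : n.-tuple R -> Prop) : Prop :=
  \forall t \ae (lebesgue_tuple R n), unit_cube R n t -> P t.

Definition ae_constant (R : realType) (T : Type) (g : R -> T) : Prop :=
  exists a : T, ae_unit (fun x => g x = a).

(* The space W_n. Its elements are classes modulo a.e. equality, hence symmetry
   is only required a.e. *)
Definition symmetric_L1 (R : realType) (n : nat) : set (n.-tuple R -> R) :=
  [set W : n.-tuple R -> R |
   (lebesgue_tuple R n).-integrable (unit_cube R n) (EFin \o W) /\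
    forall s : 'S_n, ae_cube (fun t => W [tuple tnth t (s i) | i < n] = W t)].
Arguments symmetric_L1 : clear implicits.

(* The set F_c, with f r the r-th coordinate function. *)
Definition simplex_functions (R : realType) (c : nat) :
    set ('I_c -> R -> R) :=
  [set f : 'I_c -> R -> R |
   [/\ forall r, measurable_fun (`[0, 1]%classic : set R) (f r),
    forall (r : 'I_c) (x : R), x \in `[0, 1] -> 0 <= f r x <= 1 &
    forall x : R, x \in `[0, 1] -> \sum_(r < c) f r x = 1]].
Arguments simplex_functions : clear implicits.

(* G_{W,1_r}(f) *)
Definition G_mono (R : realType) (c n : nat) (W : n.-tuple R -> R)
    (f : 'I_c -> R -> R) (r : 'I_c) : R :=
  \int[lebesgue_tuple R n]_(t in unit_cube R n)
    (W t * \prod_(a < n) f r (tnth t a)).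

(* V[W] *)
Definition V_marg (R : realType) (n : nat) (W : n.+1.-tuple R -> R)
    (x : R) : R :=
  \int[lebesgue_tuple R n]_(t in unit_cube R n) W [tuple of x :: t].

(* V_r[W,f] *)
Definition V_color (R : realType) (c n : nat) (W : n.+1.-tuple R -> R)
    (f : 'I_c -> R -> R) (r : 'I_c) (x : R) : R :=
  \int[lebesgue_tuple R n]_(t in unit_cube R n)
    (W [tuple of x :: t] * \prod_(a < n) f r (tnth t a)).

(* Since ln 0 = 0, the convention 0 log 0 = 0 holds. *)
Definition objective (R : realType) (c n : nat) (W : n.-tuple R -> R)
    (alpha h : 'I_c -> R) (f : 'I_c -> R -> R) : R :=
  \sum_(r < c) alpha r * G_mono W f r
  + \sum_(r < c) h r * \int[@lebesgue_measure R]_(u in `[0, 1]) f r u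
  - \int[@lebesgue_measure R]_(u in `[0, 1])
      (\sum_(r < c) f r u * ln (f r u)).

Definition is_maximizer (R : realType) (c n : nat) (W : n.-tuple R -> R)
    (alpha h : 'I_c -> R) (f : 'I_c -> R -> R) : Prop :=
  simplex_functions R c f /\
  forall g, simplex_functions R c g ->
    objective W alpha h g <= objective W alpha h f.

(* Main.v *)
(* Stationarity of a maximizer f is obtained without differentiating the entropy
   at the boundary of the simplex. Let q be the right-hand side of (i), the
   Gibbs measure built from f, and move from f to f + e (q - f). The terms G_r
   change by e v \int (q_r - f_r) V_r up to O(e^2), by symmetry of W and Fubini,
   and concavity bounds the entropy below by its chord. Since the linearized
   problem is the Gibbs variational principle, maximality gives
   \int KL(f || q) <= O(e), whence f = q almost everywhere.
   For (ii), if f = p then V_r = p_r^(v-1) V[W], and the log-ratios of the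
   coordinates of (i) make V[W] constant unless
   alpha_r p_r^(v-1) = alpha_s p_s^(v-1) and p_r / p_s = exp (h_r - h_s).
   For (iii), AM-GM gives G_r(f) <= \int f_r^v; comparing f with the constants
   f(x), x in [0,1], forces equality when alpha_r > 0, so that f_r is constant,
   and then (i) makes all the coordinates constant. *)

Require Import Defs.
From HB Require Import structures.
From mathcomp Require Import all_boot all_order all_algebra.
From mathcomp Require Import fingroup perm.
From mathcomp Require Import all_classical all_reals all_analysis
  measurable_realfun.
From mathcomp Require Import ring lra.

Set Implicit Arguments.
Unset Strict Implicit.
Unset Printing Implicit Defensive.
Import Order.TTheory GRing.Theory Num.Theory.
Import numFieldNormedType.Exports.
Local Open Scope classical_set_scope.
Local Open Scope ring_scope.

(** * Lebesgue measure on tuples: permutation invariance, Fubini, null sets *)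

Section lebesgue_tuple_theory.
Context {R : realType}.
Local Notation mR := (measurableTypeR R).
Local Notation leb := (@lebesgue_measure R).
Local Notation cube := (unit_cube R).
Implicit Types n : nat.

Definition box n (A : 'I_n -> set mR) : set (n.-tuple mR) :=
  [set t | forall i, A i (tnth t i)].

Lemma measurable_box n (A : 'I_n -> set mR) :
  (forall i, measurable (A i)) -> measurable (box A).
Proof.
move=> mA.
have -> : box A = \big[setI/setT]_(i < n) ((@tnth n mR)^~ i @^-1` A i).
  rewrite -bigcap_seq; apply/seteqP; split => [t At i _|t At i];
    first exact: At.
  by apply: (At i); rewrite /= mem_index_enum.
apply: bigsetI_measurable => i _; rewrite -[X in measurable X]setTI.
exact: measurable_tnth.
Qed.

Lemma lebesgue_tuple_box n (A : 'I_n -> set mR) :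
  (forall i, measurable (A i)) ->
  lebesgue_tuple R n (box A) = (\prod_(i < n) leb (A i))%E.
Proof.
elim: n A => [|n IH] A mA.
  rewrite big_ord0 /= diracE mem_set//; by move=> [].
rewrite big_ord_recl -IH; last by move=> i; exact: mA.
rewrite -product_measure1E//; last exact: measurable_box.
rewrite /= /measure_cons /pushforward; congr (_ _).
apply/seteqP; split => [[x t] /= At|[x t] /= [A0 At] i].
  split=> /=; first by have := At ord0; rewrite tnth0.
  by move=> i; have := At (lift ord0 i); rewrite tnthS.
by case: (unliftP ord0 i) => [j|] ->; rewrite ?tnthS ?tnth0.
Qed.

Definition perm_tuple n (s : 'S_n) (t : n.-tuple mR) : n.-tuple mR :=
  [tuple tnth t (s i) | i < n].

Lemma measurable_perm_tuple n (s : 'S_n) :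
  measurable_fun [set: n.-tuple mR] (perm_tuple s).
Proof.
apply/measurable_fun_tnthP => i.
rewrite (_ : _ \o _ = fun t => tnth t (s i)); first exact: measurable_tnth.
by apply/funext => t /=; rewrite tnth_mktuple.
Qed.

(** Measurable boxes are stable under intersection, generate the product sigma-algebra and are
    permuted among themselves without change of volume, so uniqueness of measures gives invariance.
    The boxes with all sides [F k] exhaust the space by sets of finite measure. *)
Lemma lebesgue_tuple_perm n (s : 'S_n) (A : set (n.-tuple mR)) :
  measurable A -> pushforward (lebesgue_tuple R n) (perm_tuple s) A =
  lebesgue_tuple R n A.
Proof.
have /sigma_finiteP[F [TF ndF Foo]] := sigma_finiteT leb.
pose C : set (set (n.-tuple mR)) :=
  [set B | exists2 D : 'I_n ->
    set mR, (forall i, measurable (D i)) & B = box D].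
move: A; apply: (measure_unique C (fun k => box (fun=> F k))).
- apply/seteqP; split; last first.
    apply: smallest_sub; first exact: sigma_algebra_measurable.
    by move=> _ [D mD ->]; exact: measurable_box.
  apply: smallest_sub; first exact: smallest_sigma_algebra.
  rewrite -bigcup_seq; apply: bigcup_sub => i _ _ [Y mY <-].
  apply: sub_sigma_algebra; exists (fun j => if j == i then Y else setT).
    by move=> j; case: ifP.
  rewrite setTI; apply/seteqP; split => [t Yt j|t /(_ i)]; last by rewrite eqxx.
  by case: eqP => [->|].
- move=> _ _ [D mD ->] [D' mD' ->]; exists (fun i => D i `&` D' i).
    by move=> i; exact: measurableI.
  apply/seteqP; split => [t [Dt D't] i|t Dt]; first by split.
  by split => i; case: (Dt i).
- by move=> k; exists (fun=> F k) => // _; case: (Foo k).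
- apply/seteqP; split => // t _.
  have H (i : 'I_n) : exists m, F m (tnth t i).
    by have : [set: mR] (tnth t i) by []; rewrite TF => -[m _ ?]; exists m.
  have [m mP] := choice H.
  (* As [F] is nondecreasing, the largest of the indices [m i] serves all coordinates at once. *)
  exists (\max_(i < n) m i)%N => // i; apply: subsetPset (mP i); apply: ndF.
  exact: leq_bigmax.
- exact: measurable_perm_tuple.
- move=> ? _ [D mD ->]; rewrite /= /pushforward [RHS]lebesgue_tuple_box//.
  have -> : perm_tuple s @^-1` box D = box (fun i => D (s^-1%g i)).
    apply/seteqP; split => t /= Dt i; last first.
      by rewrite tnth_mktuple; have := Dt (s i); rewrite permK.
    by have := Dt (s^-1%g i); rewrite tnth_mktuple permKV.
  rewrite lebesgue_tuple_box; last by move=> i; exact: mD.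
  by rewrite [RHS](reindex_inj (@perm_inj _ s^-1%g)).
- move=> ? k; rewrite /= /pushforward.
  have -> : perm_tuple s @^-1` box (fun=> F k) = box (fun=> F k).
    apply/seteqP; split => t /= Ft i; last by rewrite tnth_mktuple.
    by have := Ft (s^-1%g i); rewrite tnth_mktuple permKV.
  have [mF Fk] := Foo k; rewrite lebesgue_tuple_box//.
  rewrite -ge0_fin_numE; last by apply: prode_ge0.
  by apply: prode_fin_num => i _; rewrite ge0_fin_numE.
Qed.

(** Change of variables, applied to the extension of [f] by zero outside [D]. It serves with [phi] a
    permutation of coordinates and with [phi] the map [cons_pair]. *)
Lemma integrable_measure_preserving d d' (X : measurableType d)
    (Y : measurableType d') (phi : X -> Y) (mu : {measure set X -> \bar R})
    (nu : {measure set Y -> \bar R}) (D : set Y) (f : Y -> \bar R) :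
  measurable_fun [set: X] phi ->
  (forall A, measurable A -> pushforward mu phi A = nu A) ->
  measurable D -> nu.-integrable D f ->
  mu.-integrable (phi @^-1` D) (f \o phi) /\
  (\int[mu]_(x in phi @^-1` D) f (phi x) = \int[nu]_(y in D) f y)%E.
Proof.
move=> mphi muphi mD intf.
have mD' : measurable (phi @^-1` D) by rewrite -[X in measurable X]setTI;
  exact: mphi.
have /integrable_mkcond := intf => /(_ mD) intg.
have mg := measurable_int _ intg.
have gE : (f \_ D) \o phi = (f \o phi) \_ (phi @^-1` D) by [].
have intg' : mu.-integrable [set: X] ((f \_ D) \o phi).
  apply/integrableP; split.
    exact: measurableT_comp mg mphi.
  have := ge0_integral_pushforward mphi mu measurableT (f :=
    fun y => `|(f \_ D) y|%E).
  rewrite preimage_setT => <- //; last exact: measurableT_comp mg.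
  case/integrableP : intg => _; apply: le_lt_trans; rewrite le_eqVlt;
    apply/orP; left.
  by apply/eqP; apply: eq_measure_integral => A mA _; exact: muphi.
split; first by apply/integrable_mkcond => //; rewrite -gE.
rewrite [LHS]integral_mkcond [RHS]integral_mkcond.
have := integral_pushforward mphi mg (D := setT) intg' measurableT.
rewrite preimage_setT => eqI; rewrite -[LHS]eqI.
by apply: eq_measure_integral => A mA _; exact: muphi.
Qed.

Lemma unit_cube_box n : cube n = box (fun=> `[0, 1]%classic).
Proof. by []. Qed.

Lemma measurable_cube n : measurable (cube n : set (n.-tuple mR)).
Proof. by rewrite unit_cube_box; apply: measurable_box => _;
  exact: measurable_itv. Qed.

Lemma lebesgue_unit : leb `[0, 1]%classic = 1%E.
Proof. by rewrite lebesgue_measure_itv/= lte_fin ltr01 oppr0 adde0. Qed.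

Lemma lebesgue_tuple_cube n : lebesgue_tuple R n (cube n) = 1%E.
Proof.
rewrite unit_cube_box lebesgue_tuple_box//.
by rewrite big1// => i _; exact: lebesgue_unit.
Qed.

Lemma perm_tuple_cube n (s : 'S_n) : perm_tuple s @^-1` cube n = cube n.
Proof.
apply/seteqP; split => t /= Ft i; last by rewrite tnth_mktuple.
by have := Ft (s^-1%g i); rewrite tnth_mktuple permKV.
Qed.

Lemma integrable_cube_perm n (s : 'S_n) (F : n.-tuple mR -> R) :
  (lebesgue_tuple R n).-integrable (cube n) (EFin \o F) ->
  (lebesgue_tuple R n).-integrable (cube n) (EFin \o (F \o perm_tuple s)) /\
  \int[lebesgue_tuple R n]_(t in cube n) F (perm_tuple s t) =
  \int[lebesgue_tuple R n]_(t in cube n) F t.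
Proof.
move=> intF.
have := integrable_measure_preserving (measurable_perm_tuple s)
  (@lebesgue_tuple_perm n s) (@measurable_cube n) intF.
by rewrite perm_tuple_cube => -[intFs eqF]; split => //; rewrite /Rintegral eqF.
Qed.

Lemma cons_tuple_cube n (x : mR) (t : n.-tuple mR) :
  cube n.+1 [tuple of x :: t] <-> x \in `[0, 1] /\ cube n t.
Proof.
split=> [xt|[x01 tc] i].
  split=> [|i]; first by have := xt ord0; rewrite tnth0.
  by have := xt (lift ord0 i); rewrite tnthS.
by case: (unliftP ord0 i) => [j|] ->; rewrite ?tnthS ?tnth0.
Qed.

(** Pulling back along [cons_pair] reduces to Fubini for a product measure, applied to the extension
    [G] of [F] by zero. The inner integral is real-valued, hence agrees with [fubini_F] only where
    the latter is finite, that is, for almost every [x]. *)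
Lemma Fubini_cube n (F : n.+1.-tuple mR -> R) :
  (lebesgue_tuple R n.+1).-integrable (cube n.+1) (EFin \o F) ->
  [/\ leb.-integrable `[0, 1]%classic (EFin \o (fun x =>
        \int[lebesgue_tuple R n]_(t in cube n) F [tuple of x :: t])),
      ae_unit (fun x => (lebesgue_tuple R n).-integrable (cube n)
        (EFin \o (fun t : n.-tuple mR => F [tuple of x :: t]))) &
      \int[lebesgue_tuple R n.+1]_(t in cube n.+1) F t =
      \int[leb]_(x in `[0, 1])
        \int[lebesgue_tuple R n]_(t in cube n) F [tuple of x :: t]].
Proof.
move=> intF.
have [] := integrable_measure_preserving (@measurable_cons_pair _ mR n)
  (mu := (leb \x lebesgue_tuple R n)%E) (nu := lebesgue_tuple R n.+1)
  (fun A _ => erefl) (@measurable_cube n.+1) intF.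
have mC : measurable (@cons_pair _ mR n @^-1` cube n.+1).
  rewrite -[X in measurable X]setTI; apply: measurable_cons_pair => //.
  exact: measurable_cube.
move=> /(integrable_mkcond _ mC); rewrite integral_mkcond.
set G := (_ \_ _) => intG intGE.
have GE x t : x \in `[0, 1] ->
  G (x, t) = ((EFin \o fun t : n.-tuple mR =>
    F [tuple of x :: t]) \_ (cube n)) t.
  move=> x01; have [tc|tc] := pselect (cube n t).
    by rewrite /G !patchT ?inE//= cons_tuple_cube.
  by rewrite /G !patchN ?notin_setE//= cons_tuple_cube => -[].
have GE0 x t : x \notin `[0, 1] -> G (x, t) = 0%E.
  move=> x01; rewrite /G patchN// notin_setE /= cons_tuple_cube => -[].
  by rewrite (negbTE x01).
have intE x : x \in `[0, 1] -> fubini_F (lebesgue_tuple R n) G x =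
   (\int[lebesgue_tuple R n]_(t in cube n) (F [tuple of x :: t])%:E)%E.
  move=> x01; rewrite [RHS]integral_mkcond /fubini_F.
  by apply: eq_integral => t _; exact: GE.
have intE0 x : x \notin `[0, 1] -> fubini_F (lebesgue_tuple R n) G x = 0%E.
  by move=> x01; apply: integral0_eq => t _; exact: GE0.
have intGF := integrable_fubini_F intG.
have aefin : ae_unit (fun x => (lebesgue_tuple R n).-integrable (cube n)
        (EFin \o (fun t : n.-tuple mR => F [tuple of x :: t]))).
  apply: filterS (ae_integrable1 intG) => x /= intGx x01.
  apply/integrable_mkcond; first exact: measurable_cube.
  by apply: eq_integrable intGx => // t _; rewrite GE.
have intF1 : leb.-integrable `[0, 1]%classic (EFin \o (fun x =>
        \int[lebesgue_tuple R n]_(t in cube n) F [tuple of x :: t])).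
  apply: (le_integrable _ _ _ (integrableS _ _ _ intGF)) => //.
  - apply/measurable_EFinP.
    apply: (eq_measurable_fun (fine \o fubini_F (lebesgue_tuple R n) G)).
      by move=> x; rewrite inE => x01; rewrite /= intE.
    apply: measurableT_comp; first exact: fine_measurable.
    apply: (measurable_funS measurableT) => //.
    exact: (measurable_int _ intGF).
  (* [fine] sends infinite values to 0, so it never increases the absolute value. *)
  - move=> x /= x01; rewrite intE// /Rintegral.
    by case: (\int[_]_(_ in _) _)%E => [r| |] //=; rewrite normr0 leey.
split => //.
rewrite [LHS]/Rintegral -intGE; congr fine.
have mI : measurable (`[0, 1]%classic : set mR) by exact: measurable_itv.
rewrite -[LHS](integral12_prod_meas1 intG).
transitivity (\int[leb]_(x in `[0%R, 1%R]) fubini_F (lebesgue_tuple R n) G x)%E.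
  rewrite [RHS]integral_mkcond; apply: eq_integral => x _.
  by rewrite patchE; case: ifPn => //; rewrite notin_setE => /negP ?;
    rewrite intE0.
apply: ae_eq_integral => //.
- apply: (measurable_funS measurableT) => //.
  exact: (measurable_int _ intGF).
- exact: (measurable_int _ intF1).
apply: filterS (integrable_ae measurableT intGF) => x /= /(_ I) fx x01.
by rewrite /Rintegral -intE// fineK.
Qed.

(** The measure of a null set is the integral of the measures of its sections, so almost every
    section is null. *)
Lemma ae_cube_cons n (P : n.+1.-tuple R -> Prop) :
  ae_cube P -> ae_unit (fun x => ae_cube (fun t => P [tuple of x :: t])).
Proof.
case=> N [mN N0 sub].
pose N' := @cons_pair _ mR n @^-1` N.
have mN' : measurable N'.
  by rewrite -[X in measurable X]setTI; exact: measurable_cons_pair.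
have : (\int[leb]_x `|(lebesgue_tuple R n \o xsection N') x| = 0)%E.
  by rewrite -[RHS]N0; apply: eq_integral => x _; rewrite gee0_abs.
have mX := measurable_fun_xsection (lebesgue_tuple R n) mN'.
move/(ae_eq_integral_abs _ measurableT mX);
  apply: filterS => x /= /(_ I) Nx0 x01.
exists (xsection N' x); split=> //; first exact: measurable_xsection.
move=> t /= /not_implyP[tc nP]; rewrite /xsection /= inE; apply: sub => /=.
apply/not_implyP; split => //; exact/cons_tuple_cube.
Qed.

Lemma ae_cube_coord n (P : R -> Prop) :
  ae_unit P -> ae_cube (fun t : n.-tuple R => forall i, P (tnth t i)).
Proof.
case=> N [mN N0 sub].
have H (i : 'I_n) : ae_cube (fun t : n.-tuple R => P (tnth t i)).
  exists (box (fun j : 'I_n => if j == i then N else setT)); split.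
  - by apply: measurable_box => j; case: ifP.
  - rewrite lebesgue_tuple_box; last by move=> j; case: ifP.
    (* The other sides have infinite length; the convention [0 * +oo = 0] makes the box null. *)
    by rewrite (bigD1 i)//= eqxx [X in (X * _)%E]N0 mul0e.
  - move=> t /= /not_implyP[tc nP] j; case: eqP => [->|//].
    by apply: sub => /=; apply/not_implyP; split.
have /filter_forall : forall i, \forall t \ae lebesgue_tuple R n, unit_cube R n
  t -> P (tnth t i).
  exact: H.
by apply: filterS => t /= Pt tc i; exact: Pt.
Qed.

(** The cube has measure 1, so no null set contains it. This discards coordinates on which a
    statement does not depend. *)
Lemma ae_cube_cst n (Q : Prop) : ae_cube (fun _ : n.-tuple R => Q) -> Q.
Proof.
case=> N [mN N0 sub]; apply: contrapT => nQ.
have : (lebesgue_tuple R n (cube n) <= lebesgue_tuple R n N)%E.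
  apply: le_measure; rewrite ?inE//; first exact: measurable_cube.
  by move=> t tc; apply: sub => /= /(_ tc).
by rewrite lebesgue_tuple_cube N0 lee_fin ler10.
Qed.

Lemma ae_unit_ex (P : R -> Prop) : ae_unit P -> exists2 x, x \in `[0, 1] & P x.
Proof.
case=> N [mN N0 sub]; apply: contrapT => nP.
have : (leb `[0%R, 1%R]%classic <= leb N)%E.
  apply: le_measure; rewrite ?inE//.
  by move=> x x01; apply: sub => /= /(_ x01) ?; apply: nP; exists x.
by rewrite lebesgue_unit [X in (_ <= X)%E]N0 lee_fin ler10.
Qed.
End lebesgue_tuple_theory.

(** * Real-valued integrals under almost-everywhere hypotheses *)

Section Rintegral_theory.
Context d (T : measurableType d) (R : realType) (mu : {measure set T ->
  \bar R}).
Context (D : set T) (mD : measurable D).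
Implicit Types f g : T -> R.

Lemma ae_eq_Rintegral f g : measurable_fun D f -> measurable_fun D g ->
  (\forall x \ae mu, D x -> f x = g x) ->
  \int[mu]_(x in D) f x = \int[mu]_(x in D) g x.
Proof.
move=> mf mg fg; congr fine; apply: ae_eq_integral => //;
  try exact/measurable_EFinP.
by apply: filterS fg => x /= fg Dx; rewrite fg.
Qed.

(** Passing to the absolute value turns a sign known almost everywhere into one valid at every
    point. *)
Lemma Rintegral_ae_norm f : mu.-integrable D (EFin \o f) ->
  (\forall x \ae mu, D x -> 0 <= f x) ->
  \int[mu]_(x in D) f x = \int[mu]_(x in D) `|f x|.
Proof.
move=> intf f0; have /measurable_EFinP mf := measurable_int _ intf.
apply: ae_eq_Rintegral => //; first exact: measurableT_comp.
by apply: filterS f0 => x /= f0 Dx; rewrite ger0_norm ?f0.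
Qed.

Lemma Rintegral_ge0_ae f : mu.-integrable D (EFin \o f) ->
  (\forall x \ae mu, D x -> 0 <= f x) -> 0 <= \int[mu]_(x in D) f x.
Proof. by move=> intf f0; rewrite Rintegral_ae_norm// Rintegral_ge0. Qed.

Lemma Rintegral_eq0_ae f : mu.-integrable D (EFin \o f) ->
  (\forall x \ae mu, D x -> 0 <= f x) -> \int[mu]_(x in D) f x <= 0 ->
  \forall x \ae mu, D x -> f x = 0.
Proof.
move=> intf f0; rewrite Rintegral_ae_norm// => If0.
have intnf := integrable_norm intf.
have /(ae_eq_integral_abs _ mD (measurable_int _ intf)) :
    (\int[mu]_(x in D) `|(EFin \o f) x| = 0)%E.
  rewrite -[LHS]fineK; last exact: (integrable_fin_num _ intnf).
  by congr EFin; apply/eqP; rewrite eq_le Rintegral_ge0 ?andbT.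
by apply: filterS => x /= fx Dx; have [] := fx Dx.
Qed.

Lemma Rintegral_sum (I : Type) (s : seq I) (F : I -> T -> R) :
  (forall i, mu.-integrable D (EFin \o F i)) ->
  \int[mu]_(x in D) (\sum_(i <- s) F i x) =
    \sum_(i <- s) \int[mu]_(x in D) F i x.
Proof.
move=> intF; elim: s => [|i s IH].
  rewrite big_nil; under eq_Rintegral do rewrite big_nil.
  by rewrite Rintegral_cst// mul0r.
under eq_Rintegral do rewrite big_cons.
rewrite big_cons -IH RintegralD//.
by have := integrable_sum mD s (P := xpredT) (fun i _ => intF i);
  apply: eq_integrable => // x _; rewrite /= sumEFin.
Qed.

Lemma integrable_sumR (I : Type) (s : seq I) (F : I -> T -> R) :
  (forall i, mu.-integrable D (EFin \o F i)) ->
  mu.-integrable D (EFin \o (fun x => \sum_(i <- s) F i x)).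
Proof.
move=> intF; have := integrable_sum mD s (P := xpredT) (fun i _ => intF i).
by apply: eq_integrable => // x _; rewrite /= sumEFin.
Qed.

Lemma integrableMbounded f g (M : R) : mu.-integrable D (EFin \o f) ->
  measurable_fun D g -> (forall x, D x -> `|g x| <= M) ->
  mu.-integrable D (EFin \o (fun x => f x * g x)).
Proof.
move=> intf mg gM; apply: (integrableMl mD intf mg).
exists M; split; first exact: num_real.
by move=> N MN x Dx; apply: le_trans (gM x Dx) (ltW MN).
Qed.

End Rintegral_theory.

(** * Combining almost-everywhere statements on the interval and the cube *)

Section ae_unit_theory.
Context {R : realType}.
Implicit Types P Q : R -> Prop.

Lemma ae_unitS P Q :
  (forall x, x \in `[0, 1] -> P x -> Q x) -> ae_unit P -> ae_unit Q.
Proof.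
move=> PQ [N [mN N0 sub]]; exists N; split => // x /= /not_implyP[x01 nQ].
by apply: sub => /= /(_ x01)/(PQ _ x01).
Qed.

Lemma ae_unit_forall (I : finType) (P : I -> R -> Prop) :
  (forall i, ae_unit (P i)) -> ae_unit (fun x => forall i, P i x).
Proof.
move=> HP.
have FF : Filter (almost_everywhere (@lebesgue_measure R)).
  exact: ae_filter_ringOfSetsType.
have := @filter_forall R I _ _ FF HP.
by apply: filterS => x Px x01 i; exact: Px.
Qed.

Lemma ae_unitI P Q : ae_unit P -> ae_unit Q -> ae_unit (fun x => P x /\ Q x).
Proof.
move=> aP aQ.
have /ae_unit_forall : forall b : bool, ae_unit (if b then P else Q) by case.
by apply: ae_unitS => x _ PQ; split; [exact: (PQ true)|exact: (PQ false)].
Qed.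

Lemma ae_cubeS n (P Q : n.-tuple R -> Prop) :
  (forall t, unit_cube R n t -> P t -> Q t) -> ae_cube P -> ae_cube Q.
Proof.
move=> PQ [N [mN N0 sub]]; exists N; split => // t /= /not_implyP[tc nQ].
by apply: sub => /= /(_ tc)/(PQ _ tc).
Qed.

Lemma ae_cubeI n (P Q : n.-tuple R -> Prop) :
  ae_cube P -> ae_cube Q -> ae_cube (fun t => P t /\ Q t).
Proof.
have FF : Filter (almost_everywhere (lebesgue_tuple R n)).
  exact: ae_filter_ringOfSetsType.
move=> aP aQ; have := @filterI _ _ FF _ _ aP aQ.
by apply: filterS => t [HP HQ] tc; split; [exact: HP|exact: HQ].
Qed.

End ae_unit_theory.

(** * Relative entropy and the Gibbs variational principle *)

Section gibbs.
Context {R : realType}.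
Implicit Types y q : R.

(** Summand of the relative entropy. The correction [- y + q] makes each single term nonnegative and
    cancels in the sum over two probability vectors. *)
Definition kl y q : R := y * ln y - y * ln q - y + q.

(** For [y > 0] this is [y] times the inequality [1 + z < expR z] at [z = ln q - ln y]; for [y = 0]
    the value is [q]. *)
Lemma kl_gt0 y q : 0 <= y -> 0 < q -> y != q -> 0 < kl y q.
Proof.
rewrite le_eqVlt => /predU1P[<-|y0] q0 yq.
  by rewrite /kl !mul0r !subr0 add0r.
have z0 : ln q - ln y != 0.
  by rewrite subr_eq0; apply: contraNneq yq => /ln_inj -> //; rewrite posrE.
have := expR_gt1Dx z0; rewrite expRD expRN !lnK ?posrE// -(ltr_pM2l y0).
rewrite mulrCA divff ?gt_eqF// mulr1 /kl => ?; lra.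
Qed.

Lemma kl_ge0 y q : 0 <= y -> 0 < q -> 0 <= kl y q.
Proof.
move=> y0 q0; have [->|/(kl_gt0 y0 q0)/ltW//] := eqVneq y q.
by rewrite /kl subrr add0r addrC subrr.
Qed.

Lemma kl_eq0 y q : 0 <= y -> 0 < q -> kl y q = 0 -> y = q.
Proof.
move=> y0 q0 yq; apply/eqP; apply: contraT => /(kl_gt0 y0 q0).
by rewrite yq ltxx.
Qed.

(** No derivative is used: when the convex combination [m] is positive, the right side minus the
    left side is exactly [(1 - e) * kl a m + e * kl b m]. *)
Lemma xlnx_convex (e a b : R) : 0 <= e -> e <= 1 -> 0 <= a -> 0 <= b ->
  (a + e * (b - a)) * ln (a + e * (b - a)) <= (1 - e) * (a * ln a) + e * (b *
    ln b).
Proof.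
move=> e0 e1 a0 b0; set m := a + e * (b - a).
have mE : m = (1 - e) * a + e * b by rewrite /m; ring.
have a0' : 0 <= (1 - e) * a by rewrite mulr_ge0// subr_ge0.
have b0' : 0 <= e * b by rewrite mulr_ge0.
have : 0 <= m by rewrite mE addr_ge0.
rewrite le_eqVlt => /predU1P[m0|m0].
  (* If [m = 0], the nonnegative products [(1 - e) * a] and [e * b] both vanish, and so do both
     sides. *)
  move/esym/eqP: m0; rewrite mE paddr_eq0// => /andP[/eqP ea /eqP eb].
  by rewrite !mulrA ea eb addr0 !mul0r addr0.
have Ha : 0 <= (1 - e) * kl a m by rewrite mulr_ge0 ?subr_ge0// kl_ge0.
have Hb : 0 <= e * kl b m by rewrite mulr_ge0// kl_ge0.
rewrite -subr_ge0; apply: le_trans (addr_ge0 Ha Hb) _.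
by rewrite /kl [X in _ <= _ - X * _]mE le_eqVlt; apply/orP; left; apply/eqP;
  rewrite mE; ring.
Qed.

Lemma xlnx_bounded y : 0 <= y <= 1 -> `|y * ln y| <= 1.
Proof.
move=> /andP[y0 y1]; rewrite ler0_norm; last first.
  by rewrite mulr_ge0_le0// ln_le0.
(* Nonnegativity of [kl y 1] reads [- (y * ln y) <= 1 - y]. *)
have := kl_ge0 y0 ltr01; rewrite /kl ln1 mulr0; lra.
Qed.

Lemma sum_expR_gt0 (c : nat) (u : 'I_c -> R) (r : 'I_c) :
  0 < \sum_(s < c) expR (u s).
Proof.
rewrite (bigD1 r)//= ltr_pwDl ?expR_gt0//.
by apply: sumr_ge0 => i _; exact: expR_ge0.
Qed.

(** As [u r = ln (q r) + ln Z], the two sides differ by the sum of [(ln Z - 1) * (q r - f r)], which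
    is 0 for vectors of mass 1. Thus the gain of the linearized functional in passing from [f] to
    [q] is the relative entropy of [f] with respect to [q]. *)
Lemma gibbs_variational (c : nat) (u f : 'I_c -> R) :
  (forall r, 0 <= f r) -> \sum_(r < c) f r = 1 ->
  let Z := \sum_(s < c) expR (u s) in let q r := expR (u r) / Z in
  \sum_(r < c) (u r * (q r - f r) + (f r * ln (f r) - q r * ln (q r))) =
  \sum_(r < c) kl (f r) (q r).
Proof.
move=> f0 f1 Z q.
have Z0 : 0 < Z.
  rewrite /Z; case: c u f f0 f1 @Z @q => [|c] u f f0 f1 Z q.
    by move: f1; rewrite big_ord0 => /eqP; rewrite eq_sym oner_eq0.
  exact: (sum_expR_gt0 u ord0).
have uE r : u r = ln (q r) + ln Z.
  by rewrite /q lnM ?posrE ?expR_gt0 ?invr_gt0// lnV ?posrE// expRK subrK.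
have q1 : \sum_(r < c) q r = 1 by rewrite -mulr_suml divff ?gt_eqF.
apply/eqP; rewrite -subr_eq0 -sumrB; apply/eqP.
transitivity (\sum_(r < c) (ln Z - 1) * (q r - f r)).
  by apply: eq_bigr => r _; rewrite uE /kl; ring.
by rewrite -mulr_sumr sumrB q1 f1 subrr mulr0.
Qed.

End gibbs.

(** * First-order expansion of products, and AM-GM *)

Section products.
Context {R : realFieldType}.

(** Induction on the number of factors. [C] depends on [n] only, so that the bound can later be
    integrated against the absolute value of [W]. *)
Lemma prod_first_order n : exists2 C : R, 0 <= C &
  forall (x d : 'I_n -> R) (e : R), 0 <= e -> e <= 1 ->
  (forall a, `|x a| <= 1) -> (forall a, `|d a| <= 1) ->
  `|\prod_(a < n) (x a + e * d a) - \prod_(a < n) x a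
    - e * \sum_(b < n) \prod_(a < n) (if a == b then d a else x a)| <= C * e ^+
      2.
Proof.
elim: n => [|n [C C0 IH]].
  exists 0 => // x d e _ _ _ _; rewrite !big_ord0 mulr0 mul0r subrr subr0.
  by rewrite normr0.
exists (C + (C + n%:R)); first by rewrite !addr_ge0.
move=> x d e e0 e1 x1 d1.
rewrite !big_ord_recl /=.
under [X in _ - _ * (_ + X)]eq_bigr => b _ do rewrite big_ord_recl /=.
rewrite -mulr_sumr.
under [X in _ - _ * (_ + _ * X)]eq_bigr => b _ do
  under eq_bigr => a _ do rewrite (inj_eq lift_inj).
set S := (X in _ * (_ + _ * X)).
set P' := (X in (_ + _) * X - _ - _); set P := (X in _ - _ * X - _).
have := IH (x \o lift ord0) (d \o lift ord0) e e0 e1 (fun a =>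
  x1 _) (fun a => d1 _).
rewrite -/S -/P -/P' /=.
have S_le : `|S| <= n%:R.
  apply: le_trans (ler_norm_sum _ _ _) _.
  rewrite -[leRHS]mulr1 mulr_natl -[n in leRHS]card_ord -sumr_const.
  apply: ler_sum => b _; rewrite normr_prod prodr_ile1// => a _.
  by rewrite normr_ge0 /=; case: ifP => _; [exact: d1|exact: x1].
set E := P' - P - e * S => HE.
(* [E] is the error for the remaining factors. The new error is of order [e ^+ 2] because [E] is,
   and because the bounded term [S] carries the factor [e] twice. *)
have -> : (x ord0 + e * d ord0) * P' - x ord0 * P - e * (d ord0 * P + x ord0 *
  S)
  = x ord0 * E + e * d ord0 * (E + e * S) by rewrite /E; ring.
apply: le_trans (ler_normD _ _) _; rewrite mulrDl lerD//.
  by rewrite normrM -[leRHS]mul1r ler_pM.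
rewrite !normrM (ger0_norm e0).
have -> : (C + n%:R) * e ^+ 2 = e * 1 * (C * e + n%:R * e) by ring.
rewrite ler_pM ?ler_wpM2l ?mulr_ge0//.
apply: le_trans (ler_normD _ _) _; rewrite lerD//.
  apply: le_trans HE _; rewrite expr2 mulrA ler_piMr// mulr_ge0//.
by rewrite normrM (ger0_norm e0) mulrC ler_wpM2r.
Qed.

(* The power mean inequality is AM-GM applied to the [x i ^+ n.+1]. *)
Lemma prod_le_mean_pow n (x : 'I_n.+1 -> R) : (forall i, 0 <= x i) ->
  \prod_(i < n.+1) x i <= (\sum_(i < n.+1) x i ^+ n.+1) / n.+1%:R
    ?= iff [forall i, forall j, x i == x j].
Proof.
move=> x0.
have xn0 : {in 'I_n.+1, forall i, 0 <= x i ^+ n.+1}.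
  by move=> i _; rewrite exprn_ge0.
have := leif_AGM xn0; rewrite card_ord prodrXl.
have -> : [forall i in 'I_n.+1, forall j in 'I_n.+1, x i ^+ n.+1 == x j ^+
  n.+1] =
    [forall i, forall j, x i == x j].
  by apply: eq_forallb => i; apply: eq_forallb => j; rewrite eqrXn2.
have P0 : 0 <= \prod_(i < n.+1) x i by rewrite prodr_ge0.
have S0 : 0 <= (\sum_(i < n.+1) x i ^+ n.+1) / n.+1%:R.
  by rewrite divr_ge0// sumr_ge0// => i _; rewrite exprn_ge0.
move=> /leifP H; apply/leifP; move: H; case: ifP => _.
  by rewrite eqrXn2.
by rewrite ltr_pXn2r.
Qed.

End products.

(** * Integrating out all coordinates but one *)

Section marginals.
Context {R : realType}.
Local Notation mR := (measurableTypeR R).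
Local Notation leb := (@lebesgue_measure R).
Local Notation cube := (unit_cube R).
Local Notation I01 := (`[0%R, 1%R]%classic : set mR).

Lemma measurable_prod_coord n (F : 'I_n -> mR -> mR) :
  (forall a, measurable_fun I01 (F a)) ->
  measurable_fun (cube n : set (n.-tuple mR)) (fun t =>
    \prod_(a < n) F a (tnth t a)).
Proof.
move=> mF; apply: measurable_prod => a _.
apply: (measurable_comp (F := I01) (f := F a)) => //.
- by move=> _ [t tc <-]; exact: tc.
- exact: (measurable_funS measurableT (@subsetT _ _) (measurable_tnth a)).
Qed.

Lemma prod_coord_le1 n (F : 'I_n -> R -> R) (t : n.-tuple R) :
  (forall a x, x \in `[0, 1] -> `|F a x| <= 1) -> cube n t ->
  `|\prod_(a < n) F a (tnth t a)| <= 1.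
Proof.
move=> F1 tc; rewrite normr_prod prodr_ile1// => a _.
by rewrite normr_ge0/=; apply: F1; exact: tc.
Qed.

Lemma integrable_prod_coord n (W : n.-tuple R -> R) (F : 'I_n -> R -> R) :
  (lebesgue_tuple R n).-integrable (cube n) (EFin \o W) ->
  (forall a, measurable_fun I01 (F a : mR -> mR)) ->
  (forall a x, x \in `[0, 1] -> `|F a x| <= 1) ->
  (lebesgue_tuple R n).-integrable (cube n)
    (EFin \o (fun t => W t * \prod_(a < n) F a (tnth t a))).
Proof.
move=> intW mF F1.
apply: (integrableMbounded (measurable_cube (n := n)) intW (M := 1)
  (measurable_prod_coord mF)).
by move=> t; exact: prod_coord_le1.
Qed.

Lemma integrable_unit_bounded (u : mR -> R) (M : R) : measurable_fun I01 u ->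
  (forall x, x \in `[0, 1] -> `|u x| <= M) -> leb.-integrable I01 (EFin \o u).
Proof.
move=> mu uM; apply: measurable_bounded_integrable => //.
  by change (leb `[0%R, 1%R]%classic < +oo)%E; rewrite lebesgue_unit ltry.
exists M; split; first exact: num_real.
by move=> N MN x x01; apply: le_trans (uM x x01) (ltW MN).
Qed.

Context (c k : nat) (W : k.+1.-tuple R -> R) (hW : symmetric_L1 R k.+1 W).

(** Fubini applied to a product whose first factor is the constant 1 and whose other [k] factors are
    [f r]. *)
Lemma integrable_V_color (f : 'I_c -> R -> R) (r : 'I_c) :
  measurable_fun I01 (f r : mR -> mR) ->
  (forall x, x \in `[0, 1] -> `|f r x| <= 1) ->
  leb.-integrable I01 (EFin \o V_color W f r) /\
  ae_unit (fun x => (lebesgue_tuple R k).-integrable (cube k)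
    (EFin \o (fun t : k.-tuple mR =>
      W [tuple of x :: t] * \prod_(a < k) f r (tnth t a)))).
Proof.
move=> mf f1; case: hW => intW _.
have intF := integrable_prod_coord intW
  (F := fun a : 'I_k.+1 => if a == ord0 then (fun=> 1) else f r).
have FE (x : mR) (t : k.-tuple mR) :
    W [tuple of x :: t] * \prod_(a < k.+1) (if a == ord0 then fun=> 1 else f r)
      (tnth [tuple of x :: t] a) =
    W [tuple of x :: t] * \prod_(a < k) f r (tnth t a).
  rewrite big_ord_recl eqxx mul1r; congr (_ * _).
  by apply: eq_bigr => a _; rewrite tnthS.
have [||int1 aeF _] := Fubini_cube (intF _ _).
- by move=> a; case: ifP.
- by move=> a x x01; case: ifP => _; rewrite ?normr1 ?f1.
split.
  apply: eq_integrable int1 => // x _; congr EFin; apply: eq_Rintegral => t _.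
  exact: FE.
apply: ae_unitS aeF => x x01 aeF; apply: eq_integrable aeF => //.
  exact: measurable_cube.
by move=> t _; congr EFin; exact: FE.
Qed.

(** Transposing [ord0] and [b] brings [d] to the first coordinate, symmetry restores [W], and Fubini
    integrates out the other [k] coordinates. The value does not depend on [b], whence the factor
    [v] in the derivative of [G_mono]. *)
Lemma marginal_int (f : 'I_c -> R -> R) (r : 'I_c) (d : R -> R) (b : 'I_k.+1) :
  measurable_fun I01 (f r : mR -> mR) -> measurable_fun I01 (d : mR -> mR) ->
  (forall x, x \in `[0, 1] -> `|f r x| <= 1) ->
  (forall x, x \in `[0, 1] -> `|d x| <= 1) ->
  \int[lebesgue_tuple R k.+1]_(t in cube k.+1)
    (W t * \prod_(a < k.+1) (if a == b then d else f r) (tnth t a)) =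
  \int[leb]_(x in `[0, 1]) (V_color W f r x * d x).
Proof.
move=> mf md f1 d1; case: (hW) => intW symW.
pose F b (t : k.+1.-tuple R) :=
  W t * \prod_(a < k.+1) (if a == b then d else f r) (tnth t a).
have intF b' : (lebesgue_tuple R k.+1).-integrable (cube k.+1) (EFin \o F b').
  apply: (integrable_prod_coord intW (F :=
    fun a => if a == b' then d else f r)).
    by move=> a; case: ifP.
  by move=> a x x01; case: ifP => _; rewrite ?f1 ?d1.
have [intFs eqFs] := integrable_cube_perm (tperm ord0 b) (intF ord0).
transitivity (\int[lebesgue_tuple R k.+1]_(t in cube k.+1) F ord0 (perm_tuple
  (tperm ord0 b) t)).
  apply: ae_eq_Rintegral; first exact: measurable_cube.
  - by have /measurable_EFinP := measurable_int _ (intF b).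
  - by have /measurable_EFinP := measurable_int _ intFs.
  apply: ae_cubeS (symW (tperm ord0 b)) => t tc Wt.
  rewrite /F Wt; congr (_ * _).
  rewrite [RHS](reindex_inj (@perm_inj _ (tperm ord0 b))).
  apply: eq_bigr => a _; rewrite tnth_mktuple tpermK.
  congr ((if _ then _ else _) _).
  by rewrite -(inj_eq (@perm_inj _ (tperm ord0 b)) a b) tpermR.
rewrite eqFs; have [intF1 _ ->] := Fubini_cube (intF ord0).
have [intV aeV] := integrable_V_color mf f1.
apply: ae_eq_Rintegral => //.
- by have /measurable_EFinP := measurable_int _ intF1.
- apply: measurable_funM => //.
  by have /measurable_EFinP := measurable_int _ intV.
(* Integrability of the section, known for almost every [x], lets the factor [d x] leave the inner
   integral. *)
apply: ae_unitS aeV => x x01 aeV; rewrite -RintegralZr.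
- apply: eq_Rintegral => t _.
  rewrite /F big_ord_recl eqxx tnth0 -mulrA [d x * _]mulrC; congr (_ * (_ * _)).
  by apply: eq_bigr => a _; rewrite tnthS.
- exact: measurable_cube.
- exact: aeV.
Qed.
End marginals.

(** Bookkeeping for one perturbation: [G], [H] and [E] stand for the interaction, the field and the
    integral of [f * ln f]. Index 0 refers to the maximizer, 1 to the perturbed point, 2 to the
    Gibbs measure; [dG] and [dH] are derivatives and [C] is the error. *)
Lemma variation_bound (R : realFieldType) (e C G0 G1 H0 dH dG E0 E1 E2 : R) :
  G1 + (H0 + e * dH) - E1 <= G0 + H0 - E0 ->
  E1 <= (1 - e) * E0 + e * E2 -> G0 + e * dG - C <= G1 ->
  e * (dG + dH + E0 - E2) <= C.
Proof. by move=> *; lra. Qed.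

Lemma le0_of_linear_bound (R : realFieldType) (K C : R) : 0 <= C ->
  (forall e, 0 < e -> e <= 1 -> K <= C * e) -> K <= 0.
Proof.
move=> C0 bound; rewrite leNgt; apply/negP => K0.
have KC0 : 0 < K + C + 1 by rewrite ltr_wpDl// addr_ge0// ltW.
(* This value of [e] lies in []0, 1]] and satisfies [C * e < K]. *)
have e0 : 0 < K / (K + C + 1) by rewrite divr_gt0.
have e1 : K / (K + C + 1) <= 1 by rewrite ler_pdivrMr// mul1r; lra.
have := bound _ e0 e1; rewrite mulrCA -[X in X <= _]mulr1 ler_pM2l//.
by rewrite ler_pdivlMr// mul1r => ?; lra.
Qed.

(** * First variation and the Gibbs equation for maximizers *)

Section stationarity.
Context {R : realType}.
Local Notation mR := (measurableTypeR R).
Local Notation leb := (@lebesgue_measure R).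
Local Notation cube := (unit_cube R).
Local Notation I01 := (`[0%R, 1%R]%classic : set mR).
Context (c k : nat) (W : k.+1.-tuple R -> R) (hW : symmetric_L1 R k.+1 W).

(** Integrating [prod_first_order] against the absolute value of [W] multiplies its constant by the
    L1 norm of [W]. The linear term is a sum of [k.+1] integrals, all equal by [marginal_int]. *)
Lemma G_mono_first_order (f d : 'I_c -> R -> R) (r : 'I_c) :
  measurable_fun I01 (f r : mR -> mR) -> measurable_fun I01 (d r : mR -> mR) ->
  (forall x, x \in `[0, 1] -> `|f r x| <= 1) ->
  (forall x, x \in `[0, 1] -> `|d r x| <= 1) ->
  exists2 C : R, 0 <= C & forall e, 0 <= e -> e <= 1 ->
    (forall x, x \in `[0, 1] -> `|f r x + e * d r x| <= 1) ->
    `|G_mono W (fun s x => f s x + e * d s x) r - G_mono W f r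
      - e * (k.+1%:R * \int[leb]_(x in `[0, 1]) (V_color W f r x * d r x))|
    <= C * e ^+ 2.
Proof.
move=> mf md f1 d1; have [intW _] := hW.
have [C C0 HC] := @prod_first_order R k.+1.
exists (C * \int[lebesgue_tuple R k.+1]_(t in cube k.+1) `|W t|).
  by rewrite mulr_ge0// Rintegral_ge0.
move=> e e0 e1 fed1.
have mC := measurable_cube (R := R) (n := k.+1).
have intF := integrable_prod_coord intW (F := fun=> f r) (fun=> mf) (fun=> f1).
have med : measurable_fun I01 ((fun x => f r x + e * d r x) : mR -> mR).
  by apply: measurable_funD => //; exact: measurable_funM.
have intG := integrable_prod_coord intW (F := fun=> fun x => f r x + e * d r x)
  (fun=> med) (fun=> fed1).
have intb (b : 'I_k.+1) : (lebesgue_tuple R k.+1).-integrable (cube k.+1)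
    (EFin \o (fun t => W t * \prod_(a < k.+1) (if a == b then d r else f r)
      (tnth t a))).
  apply: (integrable_prod_coord intW (F :=
    fun a => if a == b then d r else f r)).
    by move=> a; case: ifP.
  by move=> a x x01; case: ifP => _; [exact: d1|exact: f1].
have -> : k.+1%:R * \int[leb]_(x in `[0, 1]) (V_color W f r x * d r x) =
    \sum_(b < k.+1) \int[lebesgue_tuple R k.+1]_(t in cube k.+1)
      (W t * \prod_(a < k.+1) (if a == b then d r else f r) (tnth t a)).
  rewrite (eq_bigr _ (fun b _ => marginal_int hW b mf md f1 d1)).
  by rewrite sumr_const card_ord mulr_natl.
have intS := integrable_sumR mC (index_enum 'I_k.+1) intb.
rewrite -(Rintegral_sum mC _ intb) -(RintegralZl e mC intS) /G_mono.
have intS' := integrableZl mC e intS.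
have intGF := integrableB mC intG intF.
rewrite -(RintegralB mC intG intF) -(RintegralB mC intGF intS').
have intD := integrableB mC intGF intS'.
apply: le_trans (le_normr_Rintegral mC intD) _.
rewrite -mulrA [X in C * X]mulrC mulrA.
have intnW := integrable_norm intW.
rewrite -(RintegralZl (C * e ^+ 2) mC intnW).
apply: le_Rintegral => //;
  [exact: integrable_norm intD|exact: (integrableZl mC (C * e ^+ 2) intnW)|].
move=> t tc.
rewrite -mulr_sumr mulrCA -!mulrBr normrM mulrC ler_wpM2r//.
rewrite -[X in e * X](_ : \sum_(b < k.+1) \prod_(a < k.+1)
  (if a == b then d r (tnth t a) else f r (tnth t a)) = _); last first.
  by apply: eq_bigr => b _; apply: eq_bigr => a _; case: ifP.
apply: (HC (fun a => f r (tnth t a)) (fun a => d r (tnth t a))) => // a.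
- exact/f1/tc.
- exact/d1/tc.
Qed.


Lemma simplex_norm_le1 (f : 'I_c -> R -> R) (r : 'I_c) (x : R) :
  simplex_functions R c f -> x \in `[0, 1] -> `|f r x| <= 1.
Proof. by case=> _ f01 _ x01; have /andP[f0 f1] := f01 r x x01;
  rewrite ger0_norm. Qed.

Lemma simplex_convex (f g : 'I_c -> R -> R) (e : R) : 0 <= e -> e <= 1 ->
  simplex_functions R c f -> simplex_functions R c g ->
  simplex_functions R c (fun r x => f r x + e * (g r x - f r x)).
Proof.
move=> e0 e1 [mf f01 f1] [mg g01 g1]; split.
- move=> r; apply: measurable_funD => //; apply: measurable_funM => //.
  exact: measurable_funB.
- move=> r x x01; have /andP[f0 f2] := f01 r x x01;
  have /andP[g0 g2] := g01 r x x01.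
  have := mulr_ge0 e0 g0; have := ler_piMr e0 g2.
  have e1' : 0 <= 1 - e by rewrite subr_ge0.
  have := mulr_ge0 e1' f0; have := ler_piMr e1' f2; move=> *; apply/andP;
    split; lra.
- move=> x x01; rewrite big_split/= -mulr_sumr sumrB f1// g1//.
  by rewrite subrr mulr0 addr0.
Qed.

Lemma measurable_xlnx (f : mR -> R) :
  measurable_fun I01 f -> measurable_fun I01 (fun x => f x * ln (f x)).
Proof.
by move=> mf; apply: measurable_funM => //;
  apply: (measurableT_comp (@measurable_ln R) mf).
Qed.

Lemma integrable_xlnx (f : 'I_c -> R -> R) (r : 'I_c) :
  simplex_functions R c f ->
  leb.-integrable I01 (EFin \o (fun x => f r x * ln (f r x))).
Proof.
move=> [mf f01 _]; apply: (integrable_unit_bounded (M := 1)).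
  by apply: measurable_xlnx; exact: mf.
by move=> x x01; apply: xlnx_bounded; exact: f01.
Qed.

Lemma maximizer_gibbs (alpha h : 'I_c -> R) (f : 'I_c -> R -> R) :
  is_maximizer W alpha h f -> ae_unit (fun x => forall r : 'I_c, f r x =
    expR (alpha r * k.+1%:R * V_color W f r x + h r)
    / \sum_(s < c) expR (alpha s * k.+1%:R * V_color W f s x + h s)).
Proof.
move=> [fF fmax].
pose u r x := alpha r * k.+1%:R * V_color W f r x + h r.
pose Z x := \sum_(s < c) expR (u s x).
pose q r x := expR (u r x) / Z x.
have mI : measurable I01 by exact: measurable_itv.
have [mf f01 f1] := fF.
have fn1 r x := simplex_norm_le1 r (x := x) fF.
have intV r := (integrable_V_color hW (mf r) (fn1 r)).1.
have intu r : leb.-integrable I01 (EFin \o u r).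
  have inth : leb.-integrable I01 (EFin \o (fun=> h r)).
    by apply: (integrable_unit_bounded (M := `|h r|)).
  exact: (integrableD mI (integrableZl mI (alpha r * k.+1%:R) (intV r)) inth).
have mu r : measurable_fun I01 (u r : mR -> mR).
  by have /measurable_EFinP := measurable_int _ (intu r).
have Z0 x : x \in `[0, 1] -> 0 < Z x.
  move=> x01; have [r _ |] := pickP 'I_c; last first.
    move=> c0; have := f1 x x01; rewrite big_pred0 => [/eqP|r].
      by rewrite eq_sym oner_eq0.
    by have := c0 r.
  exact: (sum_expR_gt0 (u ^~ x) r).
have mexp r : measurable_fun I01 ((fun x => expR (u r x)) : mR -> mR).
  exact: (measurableT_comp (@measurable_expR R) (mu r)).
have mZ : measurable_fun I01 (Z : mR -> mR) by exact: measurable_sum.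
have mlnZ : measurable_fun I01 ((fun x => ln (Z x)) : mR -> mR).
  exact: (measurableT_comp (@measurable_ln R) mZ).
have mq r : measurable_fun I01 (q r : mR -> mR).
  (* Moving [Z] into the exponent avoids a division. *)
  apply: (eq_measurable_fun (fun x => expR (u r x - ln (Z x)))).
    by move=> x; rewrite inE => x01; rewrite expRD expRN lnK// posrE Z0.
  exact: (measurableT_comp (@measurable_expR R) (measurable_funB (mu r) mlnZ)).
have qF : simplex_functions R c q.
  have q1 x : x \in `[0, 1] -> \sum_(r < c) q r x = 1.
    by move=> x01; rewrite -mulr_suml divff// gt_eqF// Z0.
  have q0 r x : x \in `[0, 1] -> 0 <= q r x.
    by move=> x01; rewrite divr_ge0 ?expR_ge0// ltW// Z0.
  split => // r x x01; rewrite q0//= -(q1 x x01) (bigD1 r)//= lerDl.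
  by apply: sumr_ge0 => i _; apply: q0.
pose d r x := q r x - f r x.
have md r : measurable_fun I01 (d r : mR -> mR).
  exact: (measurable_funB (mq r) (mf r)).
have dn1 r x : x \in `[0, 1] -> `|d r x| <= 1.
  move=> x01; have [_ q01 _] := qF.
  have /andP[? ?] := q01 r x x01; have /andP[? ?] := f01 r x x01.
  by rewrite ler_norml /d; apply/andP; split; lra.
have intd r : leb.-integrable I01 (EFin \o d r).
  exact: (integrable_unit_bounded (md r) (dn1 r)).
have intVd r : leb.-integrable I01 (EFin \o (fun x => V_color W f r x * d r x)).
  exact: (integrableMbounded mI (intV r) (md r) (dn1 r)).
have intud r : leb.-integrable I01 (EFin \o (fun x => u r x * d r x)).
  exact: (integrableMbounded mI (intu r) (md r) (dn1 r)).
have intf r := integrable_xlnx r fF.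
have intq r := integrable_xlnx r qF.
pose Ent (g : 'I_c -> R -> R) :=
  \int[leb]_(x in `[0, 1]) (\sum_(r < c) g r x * ln (g r x)).
pose A r := \int[leb]_(x in `[0, 1]) (V_color W f r x * d r x).
pose B r := \int[leb]_(x in `[0, 1]) d r x.
(* [D] is the derivative at [f], in the direction [q - f], of the interaction and field terms. *)
pose D := \sum_(r < c) (alpha r * (k.+1%:R * A r) + h r * B r).
have intk r : leb.-integrable I01 (EFin \o (fun x =>
    u r x * d r x + (f r x * ln (f r x) - q r x * ln (q r x)))).
  exact: (integrableD mI (intud r) (integrableB mI (intf r) (intq r))).
(* The pointwise Gibbs identity, integrated over the unit interval. *)
have KE : \int[leb]_(x in `[0, 1]) \sum_(r < c) kl (f r x) (q r x) =
    D + Ent f - Ent q.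
  transitivity (\int[leb]_(x in `[0, 1])
      \sum_(r < c) (u r x * d r x + (f r x * ln (f r x) - q r x * ln (q r x)))).
    apply: eq_Rintegral => x; rewrite inE => x01.
    apply/esym/gibbs_variational; last exact: f1.
    by move=> r; have /andP[] := f01 r x x01.
  rewrite Rintegral_sum// /Ent !Rintegral_sum// -addrA -sumrB -big_split/=.
  apply: eq_bigr => r _; rewrite RintegralD//; last first.
    exact: (integrableB mI (intf r) (intq r)).
  rewrite RintegralB//; congr (_ + _).
  rewrite mulrA -RintegralZl// -RintegralZl// -RintegralD//.
  - by apply: eq_Rintegral => x _; rewrite /u; ring.
  - exact: (integrableZl mI _ (intVd r)).
  - exact: (integrableZl mI _ (intd r)).
have HG r := G_mono_first_order (mf r) (md r) (fn1 r) (dn1 r).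
(* For every [e] in [[0, 1]] the perturbation stays in the simplex, which supplies the bound that
   the expansion asks for. *)
have {}HG r : exists C, 0 <= C /\ forall e, 0 <= e -> e <= 1 ->
    `|G_mono W (fun s x => f s x + e * d s x) r - G_mono W f r
      - e * (k.+1%:R * A r)| <= C * e ^+ 2.
  have [C C0 HC] := HG r; exists C; split=> // e e0 e1; apply: HC => // x x01.
  exact: simplex_norm_le1 (simplex_convex e0 e1 fF qF) x01.
have [C HC] := choice HG.
pose C' := \sum_(r < c) `|alpha r| * C r.
have C'0 : 0 <= C' by rewrite sumr_ge0// => r _; rewrite mulr_ge0//;
  case: (HC r).
have bound e : 0 < e -> e <= 1 -> D + Ent f - Ent q <= C' * e.
  move=> e0 e1; have gF := simplex_convex (ltW e0) e1 fF qF.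
  have := fmax _ gF; rewrite /objective.
  set g := (fun r x => f r x + e * (q r x - f r x)).
  have hE : \sum_(r < c) h r * \int[leb]_(x in `[0, 1]) g r x =
     \sum_(r < c) h r * \int[leb]_(x in `[0, 1]) f r x + e * \sum_(r < c) h r *
       B r.
    rewrite mulr_sumr -big_split/=; apply: eq_bigr => r _.
    have intf1 : leb.-integrable I01 (EFin \o f r).
      exact: (integrable_unit_bounded (mf r) (fn1 r)).
    rewrite /g RintegralD//; last exact: (integrableZl mI e (intd r)).
    rewrite (RintegralZl e mI (intd r)) -/(B r); ring.
  have EE : Ent g <= (1 - e) * Ent f + e * Ent q.
    have intg r := integrable_xlnx r gF.
    rewrite /Ent !Rintegral_sum// !mulr_sumr -big_split/=;
      apply: ler_sum => r _.
    have int1 := integrableZl mI (1 - e) (intf r).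
    have int2 := integrableZl mI e (intq r).
    rewrite -RintegralZl// -RintegralZl// -RintegralD//.
    apply: (le_Rintegral mI (intg r) (integrableD mI int1 int2)).
    move=> x x01; have [_ q01 _] := qF.
    have /andP[? ?] := q01 r x x01; have /andP[? ?] := f01 r x x01.
    by apply: xlnx_convex => //; exact: ltW.
  have GE : \sum_(r < c) alpha r * G_mono W f r
      + e * (\sum_(r < c) alpha r * (k.+1%:R * A r)) - C' * e ^+ 2
      <= \sum_(r < c) alpha r * G_mono W g r.
    rewrite mulr_sumr mulr_suml -sumrN -!big_split/=; apply: ler_sum => r _.
    have [_ /(_ e (ltW e0) e1)] := HC r; rewrite -/(g) => HCr.
    have : `|alpha r * (G_mono W g r - G_mono W f r - e * (k.+1%:R * A r))|
        <= `|alpha r| * C r * e ^+ 2 by rewrite normrM -mulrA ler_wpM2l.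
    rewrite ler_norml => /andP[H _].
    rewrite -subr_ge0 in H; rewrite -subr_ge0; apply: le_trans H _;
      rewrite le_eqVlt; apply/orP; left; apply/eqP; ring.
  rewrite -/(Ent g) -/(Ent f) hE => Hmax.
  (* Multiplying the goal by [e] brings it to the second-order scale of the expansion. *)
  rewrite -(ler_pM2l e0) /D big_split/=.
  have -> : e * (C' * e) = C' * e ^+ 2 by ring.
  exact: variation_bound Hmax EE GE.
have K0 : D + Ent f - Ent q <= 0.
  exact: le0_of_linear_bound bound.
(* The integrand is nonnegative and its integral is at most 0, so it vanishes almost everywhere, and
   then so does each of its summands. *)
have aeK : ae_unit (fun x => \sum_(r < c) kl (f r x) (q r x) = 0).
  apply: Rintegral_eq0_ae => //; last by rewrite KE.
    have := integrable_sumR mI (index_enum 'I_c) intk.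
    apply: eq_integrable => // x; rewrite inE => x01; congr EFin.
    apply: gibbs_variational; last exact: f1.
    by move=> r; have /andP[] := f01 r x x01.
  apply: aeW => x x01; apply: sumr_ge0 => r _; apply: kl_ge0.
    by have /andP[] := f01 r x x01.
  by rewrite divr_gt0 ?expR_gt0// Z0.
apply: ae_unitS aeK => x x01 /eqP.
have q0 r : 0 < q r x by rewrite divr_gt0 ?expR_gt0// Z0.
have f0 r : 0 <= f r x by have /andP[] := f01 r x x01.
rewrite psumr_eq0; last by move=> r _; exact: kl_ge0.
by move=> /allP H r; have /eqP := H r (mem_index_enum r); exact: kl_eq0.
Qed.

End stationarity.

(** * Constant maximizers and symmetry breaking *)

Section symmetry.
Context {R : realType}.
Local Notation mR := (measurableTypeR R).
Local Notation leb := (@lebesgue_measure R).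
Local Notation cube := (unit_cube R).
Local Notation I01 := (`[0%R, 1%R]%classic : set mR).
Context (c k : nat) (W : k.+1.-tuple R -> R) (hW : symmetric_L1 R k.+1 W).

(** For almost every [t] all [k] coordinates satisfy [f r = p], so the product is [p ^+ k]; it
    leaves the integral at every [x] where the section of [W] is integrable. *)
Lemma V_color_constant (f : 'I_c -> R -> R) (r : 'I_c) (p : R) :
  measurable_fun I01 (f r : mR -> mR) ->
  (forall x, x \in `[0, 1] -> `|f r x| <= 1) ->
  ae_unit (fun x => f r x = p) ->
  ae_unit (fun x => V_color W f r x = p ^+ k * V_marg W x).
Proof.
move=> mf f1 fp; have [intW _] := hW.
have mC := measurable_cube (R := R) (n := k).
have [_ aeW _] := Fubini_cube intW.
have [_ aeV] := integrable_V_color hW mf f1.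
apply: ae_unitS (ae_unitI aeW aeV) => x x01 [intWx intVx].
rewrite mulrC /V_color /V_marg -(RintegralZr _ mC intWx).
apply: ae_eq_Rintegral => //.
- by have /measurable_EFinP := measurable_int _ intVx.
- by have /measurable_EFinP :=
  measurable_int _ (integrableZr mC (p ^+ k) intWx).
apply: ae_cubeS (ae_cube_coord k fp) => t _ tp.
by under eq_bigr => a _ do rewrite tp; rewrite prodr_const card_ord.
Qed.

(** For constant [f], the log-ratio of two Gibbs coordinates is affine in [V_marg W x], with slope
    [k.+1%:R * c0]. *)
Lemma constant_maximizer (alpha h : 'I_c -> R) (f : 'I_c -> R ->
  R) (r s : 'I_c) :
  is_maximizer W alpha h f -> ae_constant (fun x => fun r => f r x) ->
  alpha r * expR (k%:R * h r) <> alpha s * expR (k%:R * h s) ->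
  ae_constant (V_marg W).
Proof.
move=> fmax [p fp] ars; have [fF _] := fmax.
have fpr i : ae_unit (fun x => f i x = p i).
  by apply: ae_unitS fp => x _ <-.
have [mf f01 f1] := fF.
have Vp i := V_color_constant (mf i) (fun x => simplex_norm_le1 i fF) (fpr i).
pose c0 := alpha r * p r ^+ k - alpha s * p s ^+ k.
have aeL : ae_unit (fun x => [/\ 0 < p r, 0 < p s &
    ln (p r) - ln (p s) = k.+1%:R * c0 * V_marg W x + (h r - h s)]).
  have /ae_unitI /(_ (ae_unitI (maximizer_gibbs hW fmax)
     (ae_unitI (fpr r) (fpr s)))) := ae_unitI (Vp r) (Vp s).
  apply: ae_unitS => x x01 [[Vr Vs] [Gf [fr fs]]].
  pose Z := \sum_(s < c) expR (alpha s * k.+1%:R * V_color W f s x + h s).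
  have Z0 : 0 < Z by exact: sum_expR_gt0 r.
  have p0 i : f i x = p i -> 0 < p i by move=> <-;
    rewrite Gf divr_gt0 ?expR_gt0.
  have lnp i : f i x = p i ->
      ln (p i) = alpha i * k.+1%:R * V_color W f i x + h i - ln Z.
    move=> <-; rewrite Gf -/Z lnM ?posrE ?expR_gt0 ?invr_gt0//.
    by rewrite lnV ?posrE// expRK.
  split; [exact: p0|exact: p0|].
  by rewrite !lnp// Vr Vs /c0; ring.
(* If [c0 = 0], a single point gives [p r = p s * expR (h r - h s)], and cancelling [p s ^+ k] in
   [c0 = 0] contradicts the hypothesis on [r] and [s]. Otherwise the affine relation determines
   [V_marg W x]. *)
have [c00|c00] := eqVneq c0 0.
  have [x _ [pr0 ps0]] := ae_unit_ex aeL; rewrite c00 mulr0 mul0r add0r => lnE.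
  case: ars; have prE : p r = p s * expR (h r - h s).
    by rewrite -lnE expRD expRN !lnK ?posrE// mulrCA divff ?mulr1// gt_eqF.
  have psk : p s ^+ k != 0 by rewrite expf_neq0// gt_eqF.
  move/eqP: c00; rewrite subr_eq0 prE exprMn mulrCA mulrC =>
    /eqP/(mulIf psk) <-.
  by rewrite -mulrA -expRM_natl -expRD -mulrDr subrK.
exists ((ln (p r) - ln (p s) - (h r - h s)) / (k.+1%:R * c0)).
apply: ae_unitS aeL => x x01 [_ _ ->].
by rewrite addrK mulrC mulKf// mulf_neq0// pnatr_eq0.
Qed.

(** With the constant 1 on all coordinates but [b], [marginal_int] produces [V_marg W], which is
    1. *)
Lemma int_W_coord (g : R -> R) (b : 'I_k.+1) :
  ae_unit (fun x => V_marg W x = 1) ->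
  measurable_fun I01 (g : mR -> mR) ->
  (forall x, x \in `[0, 1] -> `|g x| <= 1) ->
  (lebesgue_tuple R k.+1).-integrable (cube k.+1) (EFin \o (fun t =>
    W t * g (tnth t b))) /\
  \int[lebesgue_tuple R k.+1]_(t in cube k.+1) (W t * g (tnth t b)) =
  \int[leb]_(x in `[0, 1]) g x.
Proof.
move=> V1 mg g1; have [intW _] := hW.
(* A family with a single colour, so that the constant 1 has the form that [V_color] takes. *)
pose one := fun (_ : 'I_1) (_ : R) => 1 : R.
have gE (t : k.+1.-tuple mR) :
    \prod_(a < k.+1) (if a == b then g else one ord0) (tnth t a) =
    g (tnth t b).
  rewrite (bigD1 b)//= eqxx big1 ?mulr1// => a /negbTE ab.
  by rewrite ab.
have m1 : measurable_fun I01 (one ord0 : mR -> mR).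
  exact: (measurable_cst (1 : R)).
have one1 x : x \in `[0, 1] -> `|one ord0 x| <= 1 by rewrite normr1.
split.
  have intWg : (lebesgue_tuple R k.+1).-integrable (cube k.+1) (EFin \o
      (fun t => W t * \prod_(a < k.+1) (if a == b then g else one ord0) (tnth t a))).
    apply: (integrable_prod_coord intW
      (F := fun a => if a == b then g else one ord0)).
      by move=> a; case: ifP.
    by move=> a x x01; case: ifP => _; [exact: g1|exact: one1].
  apply: eq_integrable intWg; first exact: measurable_cube.
  by move=> t _; rewrite /= gE.
under eq_Rintegral do rewrite -gE.
rewrite (marginal_int hW b m1 mg one1 g1).
have [intV _] := integrable_V_color hW m1 one1.
apply: ae_eq_Rintegral => //.
  apply: measurable_funM => //.
  by have /measurable_EFinP := measurable_int _ intV.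
apply: ae_unitS V1 => x x01 V1.
rewrite /V_color; under eq_Rintegral do rewrite big1// mulr1.
by rewrite -/(V_marg W x) V1 mul1r.
Qed.

(** * Replica symmetry for unit marginals, through equality in AM-GM *)

Context (V1 : ae_unit (fun x => V_marg W x = 1)).

Lemma integrable_pow (g : mR -> R) n : measurable_fun I01 g ->
  (forall x, x \in `[0, 1] -> `|g x| <= 1) ->
  leb.-integrable I01 (EFin \o (fun x => g x ^+ n)).
Proof.
move=> mg g1; apply: (integrable_unit_bounded (M := 1)).
  exact: measurable_funX.
by move=> x x01; rewrite normrX exprn_ile1// g1.
Qed.

Lemma Rintegral_unit_cst (a : R) : \int[leb]_(x in `[0, 1]) a = a.
Proof.
rewrite Rintegral_cst; last exact: measurable_itv.
by rewrite -[X in _ * fine X]/(leb `[0%R, 1%R]%classic) lebesgue_unit mulr1.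
Qed.

Lemma objective_cst (alpha h p : 'I_c -> R) :
  objective W alpha h (fun r _ => p r) =
  \sum_(r < c) alpha r * p r ^+ k.+1 + \sum_(r < c) h r * p r
  - \sum_(r < c) p r * ln (p r).
Proof.
have [intW _] := hW.
have m1 : measurable_fun I01 ((fun=> 1) : mR -> mR) := measurable_cst (1 : R).
have n1 (x : R) : x \in `[0, 1] -> `|1 : R| <= 1 by rewrite normr1.
have intW1 : \int[lebesgue_tuple R k.+1]_(t in cube k.+1) W t = 1.
  have [_] := int_W_coord (g := fun=> 1) ord0 V1 m1 n1.
  by rewrite Rintegral_unit_cst; under eq_Rintegral do rewrite mulr1.
rewrite /objective Rintegral_unit_cst; congr (_ + _ - _).
  apply: eq_bigr => r _; congr (_ * _); rewrite /G_mono.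
  under eq_Rintegral do rewrite prodr_const card_ord.
  by rewrite (RintegralZr _ (measurable_cube (n := k.+1)) intW) intW1 mul1r.
by apply: eq_bigr => r _; rewrite Rintegral_unit_cst.
Qed.

(** The deficit in AM-GM for the values of [g] at the coordinates of [t], weighted by [W]. *)
Definition gap (g : R -> R) (t : k.+1.-tuple R) : R :=
  W t * ((\sum_(a < k.+1) g (tnth t a) ^+ k.+1) / k.+1%:R
         - \prod_(a < k.+1) g (tnth t a)).

(** By [int_W_coord] every coordinate contributes the same integral of the power [k.+1], so their
    average is that integral. *)
Lemma int_gap (f : 'I_c -> R -> R) (r : 'I_c) :
  measurable_fun I01 (f r : mR -> mR) ->
  (forall x, x \in `[0, 1] -> `|f r x| <= 1) ->
  (lebesgue_tuple R k.+1).-integrable (cube k.+1) (EFin \o gap (f r)) /\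
  \int[lebesgue_tuple R k.+1]_(t in cube k.+1) gap (f r) t =
  \int[leb]_(x in `[0, 1]) f r x ^+ k.+1 - G_mono W f r.
Proof.
move=> mf f1; have [intW _] := hW.
have mC := measurable_cube (R := R) (n := k.+1).
have mfX : measurable_fun I01 ((fun x => f r x ^+ k.+1) : mR ->
  mR) by exact: measurable_funX.
have fX1 x : x \in `[0, 1] -> `|f r x ^+ k.+1| <= 1.
  by move=> x01; rewrite normrX exprn_ile1// f1.
have intb b := (int_W_coord b V1 mfX fX1).1.
have eqb b := (int_W_coord b V1 mfX fX1).2.
have intG := integrable_prod_coord intW (F := fun=> f r) (fun=> mf) (fun=> f1).
have intS := integrable_sumR mC (index_enum 'I_k.+1) intb.
have intS' := integrableZl mC k.+1%:R^-1 intS.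
have gapE t : gap (f r) t =
  k.+1%:R^-1 * (\sum_(b < k.+1) W t * f r (tnth t b) ^+ k.+1)
    - W t * \prod_(a < k.+1) f r (tnth t a).
  by rewrite /gap -mulr_sumr; ring.
have intB := integrableB mC intS' intG.
split; first by apply: eq_integrable intB => // t _; rewrite /= gapE.
under eq_Rintegral do rewrite gapE.
rewrite (RintegralB mC intS' intG) (RintegralZl _ mC intS) (Rintegral_sum mC _
  intb).
rewrite (eq_bigr _ (fun b _ =>
  eqb b)) sumr_const card_ord -[X in _ * X]mulr_natl.
by rewrite mulKf// pnatr_eq0.
Qed.

(** Freezing the first coordinate at a good [x] leaves [g y = g x] for almost every second
    coordinate [y]. *)
Lemma ae_cube2_constant (g : R -> R) (k' : nat) :
  ae_cube (fun t : k'.+2.-tuple R =>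
    g (tnth t ord0) = g (tnth t (lift ord0 ord0))) ->
  exists a, ae_unit (fun x => g x = a).
Proof.
move=> /ae_cube_cons/ae_unit_ex[x x01 /ae_cube_cons aey].
exists (g x); apply: ae_unitS aey => y y01 aet; apply/esym.
apply: (@ae_cube_cst _ k'); apply: ae_cubeS aet => t _.
by rewrite tnth0 tnthS tnth0.
Qed.


(** For each [x] in the unit interval, the constant with value [f x] is admissible, so its objective
    is at most that of [f]. Averaging over [x] reproduces the field and entropy terms of [f], which
    cancel; the interaction terms leave the gaps. *)
Lemma maximizer_gap (alpha h : 'I_c -> R) (f : 'I_c -> R -> R) :
  is_maximizer W alpha h f ->
  \sum_(r < c) alpha r *
    \int[lebesgue_tuple R k.+1]_(t in cube k.+1) gap (f r) t <= 0.
Proof.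
move=> [fF fmax]; have [mf f01 f1] := fF.
have mI : measurable I01 by exact: measurable_itv.
have fn1 r x := simplex_norm_le1 r (x := x) fF.
have intfX r : leb.-integrable I01 (EFin \o (fun x => f r x ^+ k.+1)).
  exact: (integrable_pow k.+1 (mf r) (fn1 r)).
have intf r : leb.-integrable I01 (EFin \o f r).
  exact: (integrable_unit_bounded (mf r) (fn1 r)).
have intE r := integrable_xlnx r fF.
have int1 r := integrableZl mI (alpha r) (intfX r).
have int2 r := integrableZl mI (h r) (intf r).
have intS1 := integrable_sumR mI (index_enum 'I_c) int1.
have intS2 := integrable_sumR mI (index_enum 'I_c) int2.
have intS3 := integrable_sumR mI (index_enum 'I_c) intE.
have int12 := integrableD mI intS1 intS2.
have intP := integrableB mI int12 intS3.
have intM : leb.-integrable I01 (EFin \o (fun=> objective W alpha h f)).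
  by apply: (integrable_unit_bounded (M := `|objective W alpha h f|)).
have : \int[leb]_(x in `[0, 1])
    (\sum_(r < c) alpha r * f r x ^+ k.+1 + \sum_(r < c) h r * f r x
     - \sum_(r < c) f r x * ln (f r x)) <= objective W alpha h f.
  rewrite -[leRHS]Rintegral_unit_cst;
    apply: (le_Rintegral mI intP intM) => x x01.
  rewrite -objective_cst; apply: fmax; split => [r|r y _|y _].
  - exact: measurable_cst.
  - exact: f01.
  - exact: f1.
rewrite (RintegralB mI int12 intS3) (RintegralD mI intS1 intS2).
rewrite (Rintegral_sum mI _ int1) (Rintegral_sum mI _ int2).
rewrite /objective lerD2r.
have -> : \sum_(r < c) \int[leb]_(x in I01) (h r * f r x) =
    \sum_(r < c) h r * \int[leb]_(u in `[0, 1]) f r u.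
  by apply: eq_bigr => r _; rewrite (RintegralZl _ mI (intf r)).
rewrite lerD2r -subr_le0 -sumrB; apply: le_trans.
rewrite le_eqVlt; apply/orP; left; apply/eqP; apply: eq_bigr => r _.
have [_ ->] := int_gap (mf r) (fn1 r).
by rewrite mulrBr (RintegralZl _ mI (intfX r)).
Qed.

Lemma gap_ge0 (g : R -> R) : (forall x, x \in `[0, 1] -> 0 <= g x) ->
  ae_cube (fun t => 0 < W t) -> ae_cube (fun t => 0 <= gap g t).
Proof.
move=> g0; apply: ae_cubeS => t tc Wt; apply: mulr_ge0; first exact: ltW.
rewrite subr_ge0.
by rewrite (prod_le_mean_pow (x := fun a => g (tnth t a)))// => a; apply/g0/tc.
Qed.

(** The nonnegative gap vanishes almost everywhere; since [W > 0], this is the equality case of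
    AM-GM, where [f r] takes the same value at all coordinates. *)
Lemma gap0_constant (f : 'I_c -> R -> R) (r : 'I_c) : (0 < k)%N ->
  simplex_functions R c f -> ae_cube (fun t => 0 < W t) ->
  \int[lebesgue_tuple R k.+1]_(t in cube k.+1) gap (f r) t <= 0 ->
  exists a, ae_unit (fun x => f r x = a).
Proof.
move=> k0 fF W0 gap0; have [mf f01 f1] := fF.
have f0 x : x \in `[0, 1] -> 0 <= f r x by move=> x01;
  have /andP[] := f01 r x x01.
have [intG _] := int_gap (mf r) (fun x => simplex_norm_le1 r fF).
have aeg : ae_cube (fun t => gap (f r) t = 0).
  exact: (Rintegral_eq0_ae (measurable_cube (n :=
    k.+1)) intG (gap_ge0 f0 W0) gap0).
have : ae_cube (fun t : k.+1.-tuple R =>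
  forall a b, f r (tnth t a) = f r (tnth t b)).
  apply: ae_cubeS (ae_cubeI aeg W0) => t tc [/eqP + Wt].
  rewrite mulf_eq0 gt_eqF//= subr_eq0 eq_sym.
  have [|_ ->] := prod_le_mean_pow (x := fun a => f r (tnth t a)).
    by move=> a; apply/f0/tc.
  by move=> /forallP H a b; have /forallP/(_ b)/eqP := H a.
(* Here [0 < k] provides the two coordinates to compare. *)
clear -k0; case: k k0 => // k' _ H.
by apply: (@ae_cube2_constant _ k'); apply: ae_cubeS H => t _; exact.
Qed.


(** The gap integrals weighted by [alpha] are nonnegative with nonpositive sum, so [f r] is constant
    whenever [alpha r > 0]. The Gibbs equation carries this over to the remaining colours. *)
Lemma replica_symmetry (alpha h : 'I_c -> R) (f : 'I_c -> R -> R) : (0 < k)%N ->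
  ae_cube (fun t => 0 < W t) -> (forall r, 0 <= alpha r) ->
  is_maximizer W alpha h f -> ae_constant (fun x => fun r => f r x).
Proof.
move=> k0 W0 a0 fmax; have [fF _] := fmax; have [mf f01 _] := fF.
have fn1 r x := simplex_norm_le1 r (x := x) fF.
have f0 r x : x \in `[0, 1] -> 0 <= f r x by move=> x01;
  have /andP[] := f01 r x x01.
have gap_int0 r : 0 <= alpha r *
    \int[lebesgue_tuple R k.+1]_(t in cube k.+1) gap (f r) t.
  rewrite mulr_ge0//; have [intG _] := int_gap (mf r) (fn1 r).
  exact: (Rintegral_ge0_ae (measurable_cube (n :=
    k.+1)) intG (gap_ge0 (f0 r) W0)).
(* The Gibbs equation sees [V_color] only through its product with [alpha r], which is 0 when
   [alpha r = 0], whatever [f r] is. *)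
have aV r : exists u, ae_unit (fun x => alpha r * V_color W f r x = u).
  have [ar0|ar0] := eqVneq (alpha r) 0.
    by exists 0; apply: aeW => x _; rewrite ar0 mul0r.
  have [p fp] : exists p, ae_unit (fun x => f r x = p).
    apply: gap0_constant => //.
    have arp : 0 < alpha r by rewrite lt_def ar0 a0.
    rewrite -(pmulr_rle0 _ arp); apply: le_trans (maximizer_gap fmax).
    by rewrite (bigD1 r)//= lerDl sumr_ge0.
  exists (alpha r * p ^+ k).
  have := ae_unitI V1 (V_color_constant (mf r) (fn1 r) fp).
  by apply: ae_unitS => x _ [V1x ->]; rewrite V1x mulr1.
have [u uE] := choice aV.
exists (fun r => expR (u r * k.+1%:R + h r) / \sum_(s < c) expR (u s * k.+1%:R
  + h s)).
apply: ae_unitS (ae_unitI (maximizer_gibbs hW fmax) (ae_unit_forall uE)).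
move=> x _ [fx ux]; apply/funext => r; rewrite fx.
by congr (_ / _); [|apply: eq_bigr => s _]; rewrite -ux; congr expR; ring.
Qed.

End symmetry.

(* The integer v >= 2 is written k.+1, with V_marg and V_color integrating over
   the last k coordinates. *)
Theorem proposition2p9 (R : realType) (c k : nat)
    (hc : (2 <= c)%N) (hv : (2 <= k.+1)%N)
    (W : k.+1.-tuple R -> R) (hW : symmetric_L1 R k.+1 W)
    (alpha h : 'I_c -> R) :
  [/\ (forall f : 'I_c -> R -> R, is_maximizer W alpha h f ->
        forall r : 'I_c, ae_unit (fun x =>
          f r x =
            expR (alpha r * k.+1%:R * V_color W f r x + h r)
            / \sum_(s < c)
                expR (alpha s * k.+1%:R * V_color W f s x + h s))),
      ((exists r s : 'I_c,
          alpha r * expR (k%:R * h r) <> alpha s * expR (k%:R * h s)) ->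
        ~ ae_constant (V_marg W) ->
        forall f : 'I_c -> R -> R, is_maximizer W alpha h f ->
          ~ ae_constant (fun x => fun r => f r x)) &
      (ae_unit (fun x => V_marg W x = 1) ->
        ae_cube (fun t => 0 < W t) ->
        (forall r : 'I_c, 0 <= alpha r) ->
        forall f : 'I_c -> R -> R, is_maximizer W alpha h f ->
          ae_constant (fun x => fun r => f r x))].
Proof.
split=> [f fmax r|[r [s ars]] nV f fmax fc|V1 W0 a0 f fmax].
- by apply: ae_unitS (maximizer_gibbs hW fmax) => x _ ->.
- by apply: nV; exact: constant_maximizer fmax fc ars.
- exact: replica_symmetry fmax.
Qed.
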